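(* Let $F$ be a $C^1$-smooth function on a convex body $K\subset\mathbb{R}^n$, let $\|\cdot\|$ be the norm on $\mathbb{R}^n$ with unit ball $K-K$, and let $\|\cdot\|_*$ be the corresponding dual norm on $(\mathbb{R}^n)^*$. Then $$\max_{x\in K}F(x)-\min_{x\in K}F(x)\ \ge\ \min_{x\in K}\|dF(x)\|_*.$$
   Context: A convex body is a compact convex set with nonempty interior; $K-K=\{x-y:x,y\in K\}$. A function is $C^1$-smooth on a convex body if it is the restriction of a real-valued $C^1$ function defined on an open neighborhood of the body; $dF(x)\in(\mathbb{R}^n)^*$ is its differential. *)

(* Defs.v *)
From HB Require Import structures.
From mathcomp Require Import all_boot all_order all_algebra.
From mathcomp Require Import all_classical all_reals all_analysis.

Set Implicit Arguments.
Unset Strict Implicit.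
Unset Printing Implicit Defensive.

Import Order.TTheory GRing.Theory Num.Theory.
Import numFieldNormedType.Exports.

Local Open Scope classical_set_scope.
Local Open Scope ring_scope.

Definition convex_body (R : realType) (n : nat) (K : set 'rV[R]_n) : Prop :=
  [/\ compact K, convex_set (K : set (convex_lmodType 'rV[R]_n))
    & interior K !=set0].

Definition difference_body (R : realType) (n : nat) (K : set 'rV[R]_n)
    : set 'rV[R]_n :=
  [set x - y | x in K & y in K].

(* The canonical norm of the library on 'rV[R]_n is the sup norm; other norms
   on the same space are plain functions satisfying this predicate. *)
Record is_norm (R : realType) (n : nat) (N : 'rV[R]_n -> R) : Prop := IsNorm {
  is_normD : forall v w, N (v + w) <= N v + N w ;
  is_normZ : forall a v, N (a *: v) = `|a| * N v ;
  is_norm0_eq0 : forall v, N v = 0 -> v = 0 }.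

Definition norm_with_unit_ball (R : realType) (n : nat) (B : set 'rV[R]_n)
    (N : 'rV[R]_n -> R) : Prop :=
  is_norm N /\ [set v | N v <= 1] = B.

Definition dual_norm (R : realType) (n : nat) (N : 'rV[R]_n -> R)
    (l : {linear 'rV[R]_n -> R}) : R :=
  sup [set `|l v| | v in [set v | N v <= 1]].

(* The dual space is finite-dimensional, so continuity of the differential
   x |-> 'd G x is the same as continuity of its value at every vector. *)
Definition C1_on (R : realType) (n : nat) (U : set 'rV[R]_n)
    (G : 'rV[R]_n -> R) : Prop :=
  {in U, forall x, differentiable G x} /\
  forall v, {in U, continuous (fun x => 'd G x v)}.

(* F is only meaningful on K; its differential at a point of K is that of any
   C1 extension G (they all agree, K being the closure of its interior). *)
Definition C1_extension (R : realType) (n : nat) (K : set 'rV[R]_n)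
    (F G : 'rV[R]_n -> R) : Prop :=
  {in K, F =1 G} /\
  exists U : set 'rV[R]_n, [/\ open U, K `<=` U & C1_on U G].

Definition is_max (R : realType) (A : set R) (m : R) : Prop :=
  A m /\ ubound A m.

Definition is_min (R : realType) (A : set R) (m : R) : Prop :=
  A m /\ lbound A m.

(* Such a norm exists: the Minkowski gauge of the difference body. *)
Definition gauge_fun (R : realType) (n : nat) (B : set 'rV[R]_n) (v : 'rV[R]_n)
    : R :=
  inf [set t : R | 0 < t /\ B (t^-1 *: v)].

Lemma gauge_norm_with_unit_ball (R : realType) (n : nat) (B : set 'rV[R]_n) :
  compact B ->
  (forall (t : R) (x y : 'rV[R]_n), 0 <= t -> t <= 1 -> B x -> B y ->
    B (t *: x + (1 - t) *: y)) ->
  (forall x, B x -> B (- x)) -> nbhs (0 : 'rV[R]_n) B ->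
  norm_with_unit_ball B (gauge_fun B).
Proof.
move=> Bcompact Bconv BN B0.
pose S v := [set t : R | 0 < t /\ B (t^-1 *: v)].
pose N := gauge_fun B.
have ler_gt (x y : R) : (forall z, y < z -> x <= z) -> x <= y.
  by move=> h; apply/ler_addgt0Pr => e e0; apply: h; rewrite ltrDl.
have B00 : B 0.
  exact: nbhs_singleton.
have S_neq0 v : S v !=set0.
  have /nbhs_ballP[e /= e0 eB] := B0.
  have t0 : 0 < (`|v| + 1) / e by rewrite divr_gt0// ltr_wpDl.
  exists ((`|v| + 1) / e); split => //; apply: eB.
  rewrite -ball_normE /= sub0r normrN normrZ normfV gtr0_norm// invf_div.
  by rewrite mulrAC ltr_pdivrMr ?ltr_wpDl// ltr_pM2l// ltrDl.
have S_lb v : lbound (S v) 0.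
  by move=> t [/ltW].
have S_up v s t : S v s -> s <= t -> S v t.
  move=> [s0 Bs] st; have t0 : 0 < t by rewrite (lt_le_trans s0).
  split=> //.
  have := @Bconv (s / t) _ _ _ _ Bs B00.
  rewrite scaler0 addr0 scalerA mulrAC mulfV ?gt_eqF// mul1r; apply.
    by rewrite divr_ge0// ltW.
  by rewrite ler_pdivrMr// mul1r.
have N_S v t : S v t -> N v <= t.
  by move=> vt; apply: (@ge_inf _ (S v)) => //; exists 0; exact: S_lb.
have S_N v t : N v < t -> S v t.
  move=> /(inf_lt (S_neq0 v))[s /S_up vs /ltW]; exact: vs.
have N_ge0 v : 0 <= N v.
  by apply: lb_le_inf; [exact: S_neq0|exact: S_lb].
have N_triangle v w : N (v + w) <= N v + N w.
  apply/ler_addgt0Pr => e e0; have e20 : 0 < e / 2 by rewrite divr_gt0.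
  rewrite [e](splitr e) addrACA; apply: N_S.
  set s := N v + _; set t := N w + _.
  have [s0 Bs] : S v s by apply: S_N; rewrite ltrDl.
  have [t0 Bt] : S w t by apply: S_N; rewrite ltrDl.
  have st0 : 0 < s + t by rewrite addr_gt0.
  split=> //; have := @Bconv (s / (s + t)) _ _ _ _ Bs Bt.
  have -> : 1 - s / (s + t) = t / (s + t).
    by rewrite -(@mulfV _ (s + t)) ?gt_eqF// -mulrBl addrAC subrr add0r.
  rewrite !scalerA mulrAC mulfV ?gt_eqF// mul1r mulrAC mulfV ?gt_eqF// mul1r.
  rewrite -scalerDr; apply; first by rewrite divr_ge0// ltW.
  by rewrite ler_pdivrMr// mul1r lerDl ltW.
have N_leZ a v : a != 0 -> N (a *: v) <= `|a| * N v.
  move=> a0; have a1 : 0 < `|a| by rewrite normr_gt0.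
  rewrite mulrC -ler_pdivrMr//; apply: ler_gt => t /S_N[t0 Bt].
  rewrite ler_pdivrMr//; apply: N_S; split; first by rewrite mulr_gt0.
  rewrite scalerA invfM -mulrA; case: (ltrgt0P a) a0 => // ha _.
    by rewrite mulVf ?mulr1// gt_eqF.
  rewrite invrN mulNr mulVf ?lt_eqF// mulrN mulr1 scaleNr; exact: BN.
have N0 : N 0 = 0.
  apply/eqP; rewrite eq_le N_ge0 andbT; apply: ler_gt => t t0.
  by apply: N_S; split=> //; rewrite scaler0.
have N_Z a v : N (a *: v) = `|a| * N v.
  have [->|a0] := eqVneq a 0; first by rewrite scale0r normr0 mul0r N0.
  apply/eqP; rewrite eq_le N_leZ//=.
  have := @N_leZ a^-1 (a *: v); rewrite invr_eq0 => /(_ a0).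
  rewrite scalerA mulVf// scale1r normfV mulrC ler_pdivlMr ?normr_gt0//.
  by rewrite mulrC.
have N_eq0 v : N v = 0 -> v = 0.
  move=> v0; have [M [_ /(_ (`|M| + 1)) BM]] := compact_bounded Bcompact.
  have {}BM x : B x -> `|x| <= `|M| + 1.
    by apply: BM; rewrite (le_lt_trans (ler_norm _))// ltrDl.
  have M0 : 0 < `|M| + 1 by rewrite ltr_wpDl.
  apply/eqP; rewrite -normr_le0 -(mul0r (`|M| + 1)) -ler_pdivrMr//.
  apply: ler_gt => t t0; have [_ /BM] : S v t by apply: S_N; rewrite v0.
  rewrite ler_pdivrMr// normrZ normfV gtr0_norm// ler_pdivrMl//.
split; first by split.
apply/seteqP; split=> v /=; last first.
  by move=> Bv; apply: N_S; split=> //; rewrite invr1 scale1r.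
move=> v1; have /closure_id -> := compact_closed (@norm_hausdorff _ _) Bcompact.
move=> A /nbhs_ballP[e /= e0 eA].
pose d := e / (`|v| + 1).
have d0 : 0 < d by rewrite divr_gt0// ltr_wpDl.
have [d1 Bd] : S v (1 + d) by apply: S_N; rewrite (le_lt_trans v1)// ltrDl.
exists ((1 + d)^-1 *: v); split => //; apply: eA.
rewrite -ball_normE /= -{1}[v]scale1r -scalerBl normrZ.
have -> : 1 - (1 + d)^-1 = d / (1 + d).
  rewrite -[X in X - _](@mulfV _ (1 + d)) ?gt_eqF//.
  by rewrite -[X in _ - X]mul1r -mulrBl addrAC subrr add0r.
rewrite ger0_norm ?divr_ge0 ?ltW//.
rewrite mulrAC ltr_pdivrMr// (@le_lt_trans _ _ e)//.
  by rewrite /d mulrAC ler_pdivrMr ?ltr_wpDl// ler_pM2l// lerDl.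
by rewrite ltr_pMr// ltrDl.
Qed.

Lemma norm_with_unit_ball_difference_body (R : realType) (n : nat)
    (K : set 'rV[R]_n) : convex_body K ->
  norm_with_unit_ball (difference_body K) (gauge_fun (difference_body K)).
Proof.
move=> [Kcompact Kconv [x0 Kx0]]; apply: gauge_norm_with_unit_ball.
- have -> : difference_body K = (fun z => z.1 - z.2) @` (K `*` K).
    apply/seteqP; split=> [_ [x Kx [y Ky <-]]|_ [[x y] [/= Kx Ky] <-]].
      by exists (x, y).
    by exists x => //; exists y.
  apply: continuous_compact; last exact: compact_setX.
  apply: continuous_subspaceT => z; apply: cvgB; [exact: cvg_fst|exact: cvg_snd].
- have Kc t x y : 0 <= t -> t <= 1 -> K x -> K y -> K (t *: x + (1 - t) *: y).
    move=> t0 t1 /mem_set Kx /mem_set Ky.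
    have ti : Itv.spec (@Itv.num_sem R) (Itv.Real `[0%Z, 1%Z]) t.
      by rewrite /Itv.spec/= /Itv.num_sem/= in_itv/= ger0_real//= t0.
    by have := Kconv _ _ (Itv.mk ti) Kx Ky; rewrite inE.
  move=> t _ _ t0 t1 [x Kx [y Ky <-]] [x' Kx' [y' Ky' <-]].
  exists (t *: x + (1 - t) *: x'); first exact: Kc.
  exists (t *: y + (1 - t) *: y'); first exact: Kc.
  by rewrite !scalerBr opprD addrACA.
- by move=> _ [x Kx [y Ky <-]]; exists y => //; exists x => //; rewrite opprB.
- have : nbhs x0 K by [].
  move=> /nbhs_ballP[e /= e0 eK]; apply/nbhs_ballP; exists e => //= x.
  rewrite -ball_normE /= sub0r normrN => xe; exists (x0 + x).
    by apply: eK; rewrite -ball_normE /= opprD addNKr normrN.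
  exists x0; first exact: nbhs_singleton.
  by rewrite addrAC subrr add0r.
Qed.

(* Main.v *)
Require Import Defs.
From HB Require Import structures.
From mathcomp Require Import all_boot all_order all_algebra.
From mathcomp Require Import all_classical all_reals all_analysis.

Import Order.TTheory GRing.Theory Num.Theory.
Import numFieldNormedType.Exports.

(** The dual norm of a linear form [l] is the largest value of [l (p - q)] for
    [p] and [q] in [K].  So, if [c] is less than all the dual norms of the
    differentials of [G] on [K], there is at each point [x] of [K] a vector
    [p - q] with [p], [q] in [K] along which the derivative of [G] exceeds [c].
    It suffices to find two points of [K] at which the values of [G] differ by
    at least [c].

    A partition of unity makes [p] and [q] continuous functions of [x], defined
    on the whole space and with values in [K] ([continuous_selection]).  One
    would like to follow the field [p - q] during a unit of time: [G] then
    increases by [c].  The point is to do so without leaving [K].  If a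
    trajectory [x] satisfies [x 0 = \int_0^1 q (x s) ds], then
    [x t = \int_0^t p (x s) ds + \int_t^1 q (x s) ds] is, at each time [t]
    between 0 and 1, a mean of points of [K], hence belongs to [K] by convexity.
    Such a starting point is a fixed point of a continuous map with values in
    [K].
    This is carried out with Euler polygons in place of trajectories, so that
    integrals are finite means ([polygon_stays_inside]), and the increase of [G]
    along a step is controlled by the mean value theorem ([oscillation_ge]).

    Brouwer's theorem ([brouwer_bounded]) is deduced from Kuhn's combinatorial
    lemma on the labellings of a cubical grid ([kuhn_lemma]).  The latter is
    proved by a discrete degree modulo 2, namely the sum over the unit cubes of
    the cup product of the differentials of the labels: it depends only on the
    labels on the boundary, and is 1 for the simplest labels.

    The minimum of the dual norms is attained because the dual norm of the
    differential is a lower semicontinuous function of the point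
    ([lsc_attains_min]). *)

Local Open Scope classical_set_scope.
Local Open Scope ring_scope.

Set Implicit Arguments.
Unset Strict Implicit.
Unset Printing Implicit Defensive.

(** * Kuhn's lemma on cubical grids *)

Section Kuhn.
Variable n : nat.
Implicit Types (i j l : 'I_n) (D : {set 'I_n}).
Implicit Types (x q : 'I_n -> nat) (f g h : ('I_n -> nat) -> bool)
  (u v : 'I_n -> ('I_n -> nat) -> bool).

Definition step x j : 'I_n -> nat := fun l => (x l + (l == j))%N.

(** A state is a point [x] of the grid together with the set [D] of directions
    that have already been used to get there.  Functions of such states carry
    the operators [fmul f] and [walk] below; over the two-element field they
    generate an algebra in which [walk] squares to zero, and the commutator
    [cdiff f] of [walk] with [fmul f] plays the role of the differential of
    [f].  Composing these commutators is the cubical cup product. *)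
Definition cochain := ('I_n -> nat) -> {set 'I_n} -> bool.
Implicit Types phi psi : cochain.

Definition fmul f phi : cochain := fun x D => f x * phi x D.

Definition walk phi : cochain :=
  fun x D => \sum_(j | j \notin D) phi (step x j) (j |: D).

(** Marks a direction as used without moving along it.  On the lower corner of
    a cube, [walk] reads off the upper faces and [forget] the lower ones, so
    that [walk] plus [forget] is the boundary. *)
Definition forget phi : cochain :=
  fun x D => \sum_(j | j \notin D) phi x (j |: D).

(** A sum, where a commutator has a difference: signs do not matter modulo 2. *)
Definition cdiff f phi : cochain :=
  fun x D => walk (fmul f phi) x D + f x * walk phi x D.

(** Unfolded at [x] with no direction used, this is a sum over the
    sequences of as many distinct directions as [s] has indices, seen as paths
    from [x]: along the [k]-th step of the path the change of the
    label function of the [k]-th index of [s] is recorded, and the product of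
    these changes is multiplied by the value of [phi] at the end of the path. *)
Definition cdiffs u (s : seq 'I_n) phi :=
  foldr (fun i => cdiff (u i)) phi s.

Lemma add_self b : b + b = 0 :> bool.
Proof. by case: b. Qed.

(** The terms of index [(j, l)] and [(l, j)] cancel modulo 2. *)
Lemma sum_sym_eq0 (P : pred 'I_n) (c : 'I_n -> 'I_n -> bool) :
  (forall j l, c j l = c l j) ->
  \sum_(j | P j) \sum_(l | P l && (l != j)) c j l = 0.
Proof.
move=> cC.
pose S := \sum_(j | P j) \sum_(l | P l && (l < j)%N) c j l.
rewrite -[RHS](add_self S).
rewrite {2}/S [X in _ = _ + X](exchange_big_dep P)/=; last by move=> j l _ /andP[].
rewrite -big_split/=; apply: eq_bigr => j Pj.
rewrite (bigID (fun l => (l < j)%N))/=; congr (_ + _); apply: eq_big => l.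
- by rewrite -andbA; case: (P l) => //=; rewrite -val_eqE/=; case: ltngtP.
- by [].
- by rewrite -val_eqE/= Pj; case: (P l) => //=; case: ltngtP.
- by move=> _; exact: cC.
Qed.

Lemma stepC x j l : step (step x j) l = step (step x l) j.
Proof. by apply/funext => k; rewrite /step addnAC. Qed.

Lemma walk_eq0 phi x D : (forall j, j \notin D -> phi (step x j) (j |: D) = 0) ->
  walk phi x D = 0.
Proof. by move=> h; apply: big1. Qed.

Lemma in_setU1N j l D : (l \notin j |: D) = (l \notin D) && (l != j).
Proof. by rewrite in_setU1 negb_or andbC. Qed.

(** Two steps can be made in either order, with the same outcome. *)
Lemma walk_walk phi x D : walk (walk phi) x D = 0.
Proof.
rewrite /walk; under eq_bigr do under eq_bigl do rewrite in_setU1N.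
apply: (@sum_sym_eq0 (fun j => j \notin D)
  (fun j l => phi (step (step x j) l) (l |: (j |: D)))) => j l.
by rewrite stepC finset.setUCA.
Qed.

(** A differential is closed: since [walk] squares to zero, both sides are
    [walk (fmul f (walk phi))]. *)
Lemma walk_cdiff f phi : walk (cdiff f phi) = cdiff f (walk phi).
Proof.
apply/funext => x; apply/funext => D; rewrite [RHS]/cdiff walk_walk mulr0 addr0.
rewrite {1}/walk /cdiff big_split/=.
by rewrite -[X in X + _]/(walk (walk (fmul f phi)) x D) walk_walk add0r.
Qed.

Lemma forget_fmul f phi : forget (fmul f phi) = fmul f (forget phi).
Proof. by apply/funext => x; apply/funext => D; rewrite /fmul mulr_sumr. Qed.

Lemma forget_walk phi : forget (walk phi) = walk (forget phi).
Proof.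
apply/funext => x; apply/funext => D; rewrite /forget /walk.
under eq_bigr do under eq_bigl do rewrite in_setU1N.
under [RHS]eq_bigr do under eq_bigl do rewrite in_setU1N.
rewrite (exchange_big_dep (fun j => j \notin D))/=; last by move=> j l _ /andP[].
apply: eq_bigr => l lD; apply: eq_big => [j|j _]; last by rewrite finset.setUCA.
by rewrite lD eq_sym.
Qed.

Lemma forget_cdiff f phi : forget (cdiff f phi) = cdiff f (forget phi).
Proof.
apply/funext => x; apply/funext => D.
rewrite [RHS]/cdiff -forget_fmul -!forget_walk.
by rewrite /forget [f x * _]mulr_sumr -big_split.
Qed.

Lemma walk_cdiffs u s phi : walk (cdiffs u s phi) = cdiffs u s (walk phi).
Proof. by elim: s => //= i s <-; rewrite walk_cdiff. Qed.

Lemma forget_cdiffs u s phi : forget (cdiffs u s phi) = cdiffs u s (forget phi).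
Proof. by elim: s => //= i s <-; rewrite forget_cdiff. Qed.

Lemma walkD phi psi x D :
  walk (fun y E => phi y E + psi y E) x D = walk phi x D + walk psi x D.
Proof. by rewrite /walk big_split. Qed.

Lemma cdiffsD u s phi psi x D :
  cdiffs u s (fun y E => phi y E + psi y E) x D
  = cdiffs u s phi x D + cdiffs u s psi x D.
Proof.
elim: s x D => //= i s IH x D.
have -> : cdiffs u s (fun y E => phi y E + psi y E) =
    (fun y E => cdiffs u s phi y E + cdiffs u s psi y E).
  by apply/funext => y; apply/funext => E.
rewrite /cdiff walkD mulrDr.
have -> : fmul (u i) (fun y E => cdiffs u s phi y E + cdiffs u s psi y E) =
   (fun y E => fmul (u i) (cdiffs u s phi) y E + fmul (u i) (cdiffs u s psi) y E).
  by apply/funext => y; apply/funext => E; rewrite /fmul mulrDr.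
by rewrite walkD addrACA.
Qed.

Lemma eq_cdiffs u v s phi : (forall i, i \in s -> u i = v i) ->
  cdiffs u s phi = cdiffs v s phi.
Proof.
elim: s => //= i s IH uv; rewrite uv ?mem_head// IH// => j js.
by rewrite uv// inE js orbT.
Qed.

(** A set of states closed under steps supports the same calculus.  It is used
    for the states inside a face of the box, where a boundary condition makes a
    label constant, and for the states inside a single unit cube. *)
Section Stable.
Variable A : ('I_n -> nat) -> {set 'I_n} -> Prop.
Hypothesis stepA : forall x D j, A x D -> j \notin D -> A (step x j) (j |: D).

Definition vanish phi := forall x D, A x D -> phi x D = 0.

Lemma vanish_walk phi : vanish phi -> vanish (walk phi).
Proof. by move=> h x D xD; apply: walk_eq0 => j jD; apply/h/stepA. Qed.

Lemma vanish_cdiff f phi : vanish phi -> vanish (cdiff f phi).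
Proof.
move=> h x D xD; rewrite /cdiff !vanish_walk ?mulr0 ?addr0//.
by move=> y E yE; rewrite /fmul h ?mulr0.
Qed.

Lemma vanish_cdiffs u s phi : vanish phi -> vanish (cdiffs u s phi).
Proof. by move=> h; elim: s => //= i s; exact: vanish_cdiff. Qed.

Lemma cdiff_const f c phi : (forall x D, A x D -> f x = c) ->
  vanish (cdiff f phi).
Proof.
move=> fc x D xD; rewrite /cdiff (fc _ _ xD) {1}/walk.
rewrite (eq_bigr (fun j => c * phi (step x j) (j |: D))); last first.
  by move=> j jD; rewrite /fmul (fc _ _ (stepA xD jD)).
by rewrite -mulr_sumr; exact: add_self.
Qed.

Lemma cdiffs_const u i c s phi : i \in s -> (forall x D, A x D -> u i x = c) ->
  vanish (cdiffs u s phi).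
Proof.
move=> + fc; elim: s => //= j s IH; rewrite inE => /orP[/eqP <-|/IH].
  exact: cdiff_const fc.
exact: vanish_cdiff.
Qed.

End Stable.

Lemma cdiffDl f g phi x D :
  cdiff (fun y => f y + g y) phi x D = cdiff f phi x D + cdiff g phi x D.
Proof.
rewrite /cdiff mulrDl addrACA; congr (_ + _); rewrite -walkD.
by congr walk; apply/funext => y; apply/funext => E; rewrite /fmul mulrDl.
Qed.

(** The condition is imposed on whole hyperplanes, not only on the faces of the
    box: a labelling of the box can always be extended that way, and no bound
    on the other coordinates has to be carried along. *)
Definition kuhn_boundary (p : nat) u := forall i x,
  (x i = 0%N -> u i x = false) /\ (x i = p -> u i x = true).

Definition cochain1 : cochain := fun _ _ => 1.

Definition vertex p (q : {ffun 'I_n -> 'I_p}) : 'I_n -> nat := fun i => q i.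

(** The parity of the number of pairs made of a unit cube of the box and a
    monotone path from its lowest to its highest corner such that, for every
    [k], the [k]-th label changes along the [k]-th step.  It is the analogue of
    the degree of a map of the cube, in the form of the sum of a cup product of
    differentials. *)
Definition degree p u : bool :=
  \sum_(q : {ffun 'I_n -> 'I_p})
    cdiffs u (enum 'I_n) cochain1 (vertex q) finset.set0.

(** Shifting the cubes cyclically in direction [j] is a bijection; it differs
    from the translation only for the cubes of the last layer, where both terms
    vanish. *)
Lemma telescope_vertex p j (c : ('I_n -> nat) -> bool) :
  (forall x, x j = 0%N -> c x = 0) -> (forall x, x j = p -> c x = 0) ->
  \sum_(q : {ffun 'I_n -> 'I_p}) c (step (vertex q) j)
  = \sum_(q : {ffun 'I_n -> 'I_p}) c (vertex q).
Proof.
move=> c0 cp.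
pose r (q : {ffun 'I_n -> 'I_p}) : {ffun 'I_n -> 'I_p} :=
  [ffun l => if l == j then ordS (q l) else q l].
have r_inj : injective r.
  move=> q q' /ffunP e; apply/ffunP => l; have := e l; rewrite !ffunE.
  by case: eqP => // _ /ordS_inj.
rewrite [RHS](reindex_inj r_inj)/=; apply: eq_bigr => q _.
have [qp|qp] := eqVneq (q j).+1 p.
  rewrite cp ?c0//.
    by rewrite /vertex ffunE eqxx /= qp modnn.
  by rewrite /step /vertex eqxx addn1.
congr c; apply/funext => l; rewrite /step /vertex ffunE.
have [->|] := eqVneq l j; last by rewrite addn0.
by rewrite addn1 /= modn_small// ltn_neqAle qp ltn_ord.
Qed.

(** The degree depends on the boundary values only.  If [h] is the difference of
    the two labels of index [i], the difference of the degrees is the sum over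
    the cubes of a product of closed differentials in which the factor [i] is
    the differential of [h]; this product is a boundary, so that the sum
    telescopes to the faces of the box.  It vanishes there: on the faces of
    direction [i] because [h] does, on those of direction [j] because the
    label of index [j] is constant and its differential is zero. *)
Lemma degree_replace p u v i : kuhn_boundary p u -> kuhn_boundary p v ->
  (forall j, j != i -> u j = v j) -> degree p u = degree p v.
Proof.
move=> up vp uv.
suff : degree p u + degree p v = 0 by case: (degree p u); case: (degree p v).
have := enum_uniq 'I_n; have : i \in enum 'I_n by rewrite mem_enum.
rewrite /degree -big_split/=.
have : forall j, j \in enum 'I_n by move=> j; rewrite mem_enum.
move: (enum 'I_n) => s sT si; case/splitPr: si sT => s1 s2 sT.
rewrite cat_uniq/= negb_or => /and4P[_ /andP[is1 _] is2 _].
have eq1 : forall j, j \in s1 -> v j = u j.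
  by move=> j js; rewrite uv//; apply: contraNneq is1 => <-.
have eq2 : forall j, j \in s2 -> v j = u j.
  by move=> j js; rewrite uv//; apply: contraNneq is2 => <-.
pose h x := u i x + v i x.
pose w := cdiffs u s2 cochain1.
pose Z := cdiffs u s1 (fmul h w).
(* Each cube contributes its upper faces, from [walk], and its lower ones,
   from [forget]. *)
transitivity (\sum_(q : {ffun 'I_n -> 'I_p}) \sum_(j < n)
    (Z (step (vertex q) j) (j |: finset.set0) + Z (vertex q) (j |: finset.set0))).
  apply: eq_bigr => q _; rewrite /cdiffs !foldr_cat/= -!/(cdiffs _ _ _).
  rewrite (eq_cdiffs _ eq1) (eq_cdiffs _ eq2) -/w -cdiffsD.
  have -> : (fun y E => cdiff (u i) w y E + cdiff (v i) w y E) =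
      (fun y E => walk (fmul h w) y E + forget (fmul h w) y E).
    apply/funext => y; apply/funext => E; rewrite -cdiffDl /cdiff.
    by rewrite {2}/w walk_cdiffs -(forget_cdiffs u s2 cochain1) forget_fmul.
  rewrite cdiffsD -walk_cdiffs -forget_cdiffs -/Z /walk /forget -big_split/=.
  by apply: eq_bigl => j; rewrite inE.
rewrite exchange_big/=; apply: big1 => j _; rewrite big_split/=.
have Z0 a : a \in [:: 0%N; p] -> forall x, x j = a -> Z x (j |: finset.set0) = 0.
  (* A state of the hyperplane [x j = a] cannot leave it once direction [j]
     has been used. *)
  move=> a0p x xj; pose A (y : 'I_n -> nat) (E : {set 'I_n}) := j \in E /\ y j = a.
  have stepA y E l : A y E -> l \notin E -> A (step y l) (l |: E).
    move=> [jE yj] lE; split; first by rewrite in_setU1 jE orbT.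
    rewrite /step yj; case: eqVneq => [jl|]; last by rewrite addn0.
    by rewrite -jl jE in lE.
  have bdry t : kuhn_boundary p t -> forall y E, A y E -> t j y = (a == p).
    move=> tp y E [_ yj]; have [t0 t1] := tp j y.
    case: eqP => [ap|/eqP ap]; first by apply: t1; rewrite yj.
    apply: t0; rewrite yj; apply/eqP.
    by move: a0p; rewrite !inE (negbTE ap) orbF.
  suff : vanish A Z by apply; split; rewrite ?setU11.
  have := sT j; rewrite mem_cat inE => /or3P[js|/eqP ji|js].
  - exact: (cdiffs_const stepA _ js (bdry _ up)).
  - apply: vanish_cdiffs => // y E yE; rewrite /fmul /h -ji (bdry _ up _ _ yE).
    by rewrite (bdry _ vp _ _ yE) add_self mul0r.
  - apply: vanish_cdiffs => // y E yE; rewrite /fmul.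
    by rewrite /w (cdiffs_const stepA _ js (bdry _ up)) ?mulr0.
rewrite (@telescope_vertex p j (fun x => Z x (j |: finset.set0))).
- exact: add_self.
- by apply: Z0; rewrite mem_head.
- by apply: Z0; rewrite !inE eqxx orbT.
Qed.

Definition std_label i : ('I_n -> nat) -> bool := fun x => (0 < x i)%N.

(** The label of index [k] can only change along a step in direction [k] issued
    from the hyperplane [x k = 0]; hence a single path survives. *)
Lemma cdiffs_std s x D : uniq s -> (forall k, k \in s -> k \notin D) ->
  cdiffs std_label s cochain1 x D = all (fun k => x k == 0%N) s.
Proof.
elim: s x D => //= k s IH x D /andP[ks us] sD.
have kD : k \notin D by apply: sD; rewrite mem_head.
rewrite /cdiff /walk mulr_sumr -big_split (bigD1 k)//= big1 ?addr0.
  rewrite /fmul -mulrDl IH//.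
    have -> : all (fun l => step x k l == 0%N) s = all (fun l => x l == 0%N) s.
      apply: eq_in_all => l ls; rewrite /step; have [lk|] := eqVneq l k.
        by rewrite -lk ls in ks.
      by rewrite addn0.
    by rewrite /std_label /step eqxx addn1; case: (x k).
  move=> l ls; rewrite in_setU1 negb_or sD ?inE ?ls ?orbT// andbT.
  by apply: contraNneq ks => <-.
move=> j /andP[jD jk]; rewrite /fmul -mulrDl /std_label /step.
by rewrite eq_sym (negbTE jk) addn0 add_self mul0r.
Qed.

Lemma degree_std p : (0 < p)%N -> degree p std_label = 1.
Proof.
move=> p0; rewrite /degree (bigD1 [ffun=> Ordinal p0])//= big1 ?addr0.
  rewrite cdiffs_std ?enum_uniq//; last by move=> k _; rewrite inE.
  by rewrite -[1]/true; apply/allP => k _; rewrite /vertex ffunE.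
move=> q q0; rewrite cdiffs_std ?enum_uniq//; last by move=> k _; rewrite inE.
rewrite -[0]/false; apply: contra_neqF q0 => /allP q0; apply/ffunP => k; apply/val_inj.
by rewrite ffunE /=; apply/eqP/q0; rewrite mem_enum.
Qed.

(** The labels are replaced by the standard ones, one index at a time. *)
Lemma degree_kuhn_boundary p u : (0 < p)%N -> kuhn_boundary p u ->
  degree p u = 1.
Proof.
move=> p0 up.
pose t m i := if (i < m)%N then std_label i else u i.
have tp m : kuhn_boundary p (t m).
  move=> i x; rewrite /t; case: ifP => // _; rewrite /std_label.
  by split => ->//; rewrite p0.
have tE m : degree p (t m) = degree p u.
  elim: m => [//|m <-]; have [mn|mn] := ltnP m n; last first.
    congr degree; apply/funext => i; rewrite /t.
    by rewrite !(leq_trans (ltn_ord i))// ltnW.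
  apply: (@degree_replace p _ _ (Ordinal mn)) => // j jm; rewrite /t ltnS leq_eqVlt.
  by rewrite -val_eqE/= in jm; rewrite (negbTE jm).
rewrite -(tE n) -(degree_std p0); congr degree.
by apply/funext => i; rewrite /t ltn_ord.
Qed.

(** Since the degree is odd, some cube contributes to it, and a cube on which one
    of the labels is constant contributes nothing. *)
Lemma kuhn_lemma p u : (0 < p)%N -> kuhn_boundary p u ->
  exists q, (forall j, (q j < p)%N) /\ forall i, exists x y,
    [/\ forall j, (q j <= x j <= (q j).+1)%N,
        forall j, (q j <= y j <= (q j).+1)%N & u i x != u i y].
Proof.
move=> p0 up; apply/not_existsP => noq.
suff : degree p u = 0 by rewrite degree_kuhn_boundary.
apply: big1 => q _.
have /not_andP[//|/existsNP[i]] := noq (vertex q).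
  by apply: contra_notP => _ j; rewrite /vertex.
move=> ui.
pose A x (D : {set 'I_n}) := x = fun l => (vertex q l + (l \in D))%N.
have stepA x D j : A x D -> j \notin D -> A (step x j) (j |: D).
  move=> -> jD; apply/funext => l; rewrite /step -addnA in_setU1; congr addn.
  by case: eqVneq => [->|]; rewrite ?(negbTE jD) ?addn0.
apply: (@cdiffs_const _ stepA u i (u i (vertex q))).
- by rewrite mem_enum.
- move=> x D xD; have [//|uxq] := eqVneq (u i x) (u i (vertex q)).
  case: ui; exists x, (vertex q); split=> // j; last by rewrite leqnn leqnSn.
  by rewrite xD leq_addr/= -addn1 leq_add2l; case: (_ \in _).
- by apply/funext => l; rewrite inE addn0.
Qed.

End Kuhn.

(** * Brouwer's fixed point theorem *)

(** Half of a radius that is good at [x] is good for all the centers close to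
    [x], and compactness makes one radius good for all the centers. *)
Lemma lebesgue_number (R : realType) (X : pseudoMetricType R) (K : set X)
    (I : Type) (Q : I -> set X) : compact K ->
  (forall x, K x -> exists i, nbhs x (Q i)) ->
  exists2 r : R, 0 < r & forall x, K x -> exists i, ball x r `<=` Q i.
Proof.
move=> /compact_near_coveringP Kc KQ.
have : \forall r \near 0^'+, K `<=` (fun x => exists i, ball x r `<=` Q i).
  apply: Kc => x /KQ[i /nbhs_ballP[e /= e0 eQ]].
  exists (ball x (e / 2), [set r | r < e / 2]) => /=.
    split; first by apply: nbhsx_ballx; rewrite divr_gt0.
    by apply: nbhs_right_lt; rewrite divr_gt0.
  move=> [y r] [/= xy re]; exists i => z yz; apply: eQ.
  by rewrite [e]splitr; apply: ball_triangle xy _; apply: le_ball yz; exact: ltW.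
move=> rK; near (0 : R)^'+ => r; exists r => // x Kx.
have : K `<=` (fun x => exists i, ball x r `<=` Q i) by near: r; exact: rK.
exact.
Unshelve. all: by end_near. Qed.

(** Brouwer's fixed point theorem, for a map of the whole space with bounded
    image.  Without fixed point, compactness gives a radius [r] such that on
    each ball of radius [r] some coordinate of the displacement [phi x - x] has
    a constant strict sign.  Label the points of a grid of mesh less than [r] by
    the signs of the coordinates of the displacement: Kuhn's lemma produces a
    cell where all these signs change. *)
Lemma brouwer_bounded (R : realType) (n : nat) (phi : 'rV[R]_n -> 'rV[R]_n)
    (L : R) : continuous phi -> (forall x i, `|phi x ord0 i| <= L) ->
  exists x, phi x = x.
Proof.
move=> phi_cont phiL; have [n0|n0] := posnP n.
  by exists 0; apply/rowP => i; have := ltn_ord i; rewrite {2}n0.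
have L0 : 0 <= L by apply: le_trans (phiL 0 (Ordinal n0)).
apply/not_existsP => nofix.
pose C := [set x : 'rV[R]_n | forall i, x ord0 i \in `[(- L), L]].
have Cc : compact C.
  apply: (@rV_compact _ _ (fun=> `[(- L), L]%classic)) => _.
  exact: segment_compact.
pose Q (ib : 'I_n * bool) : set 'rV[R]_n := [set x : 'rV[R]_n |
  if ib.2 then x ord0 ib.1 < phi x ord0 ib.1 else phi x ord0 ib.1 < x ord0 ib.1].
have [x _|r r0 rQ] := @lebesgue_number _ _ C _ Q Cc.
  have phi_i i : (fun y => phi y ord0 i) @ x --> phi x ord0 i.
    apply: (@cvg_comp _ _ _ phi (fun M : 'rV[R]_n => M ord0 i)).
      exact: phi_cont.
    exact: coord_continuous.
  have id_i i : (fun y : 'rV[R]_n => y ord0 i) @ x --> x ord0 i.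
    exact: coord_continuous.
  have [i ix] : exists i, phi x ord0 i != x ord0 i.
    apply: contra_notP (nofix x) => /forallNP ix; apply/rowP => i.
    by apply/eqP/negPn/negP; exact: ix.
  have dist_i : (fun y : 'rV[R]_n => phi y ord0 i - y ord0 i) @ x -->
      phi x ord0 i - x ord0 i by exact: (cvgB (phi_i i) (id_i i)).
  have [lti|lti|e] := ltgtP (phi x ord0 i) (x ord0 i); last by rewrite e eqxx in ix.
    exists (i, false); rewrite -subr_lt0 in lti.
    have := @cvgr_lt _ _ _ (@nbhs_filter _ x) _ _ dist_i _ lti; apply: filterS => y.
    by rewrite /= subr_lt0.
  exists (i, true); rewrite -subr_gt0 in lti.
  have := @cvgr_gt _ _ _ (@nbhs_filter _ x) _ _ dist_i _ lti; apply: filterS => y.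
  by rewrite /= subr_gt0.
pose p := Num.bound (2 * L / r).
have Lp : 2 * L / r < p%:R by apply: archi_boundP; rewrite divr_ge0// ?mulr_ge0// ltW.
have p0 : (0 < p)%N.
  by rewrite -(@ltr_nat R) (le_lt_trans _ Lp)// divr_ge0 ?mulr_ge0// ltW.
pose pt (x : 'I_n -> nat) : 'rV[R]_n := \row_i (- L + 2 * L / p%:R * (x i)%:R).
(* The displacement may vanish at the two end values of a coordinate, so the
   labels are forced there. *)
pose u i x := (x i == p) || ((x i != 0%N) && (phi (pt x) ord0 i < pt x ord0 i)).
have [i x|q [qp qu]] := @kuhn_lemma n p u p0.
  rewrite /u; split=> ->; last by rewrite eqxx.
  by rewrite eq_sym (gtn_eqF p0).
have u1 i x : u i x -> phi (pt x) ord0 i <= pt x ord0 i.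
  move=> /orP[/eqP xp|/andP[_ /ltW//]].
  rewrite mxE xp divfK ?gt_eqF ?ltr0n//.
  have -> : - L + 2 * L = L by rewrite mulr2n mulrDl mul1r addKr.
  by apply: le_trans (ler_norm _) _.
have u0 i x : u i x = false -> pt x ord0 i <= phi (pt x) ord0 i.
  move=> /negbT; rewrite negb_or negb_and negbK => /andP[_ /orP[/eqP x0|]].
    rewrite mxE x0 mulr0 addr0 lerNl.
    by apply: le_trans (ler_norm _) _; rewrite normrN.
  by rewrite -leNgt.
have Lp0 : 0 <= 2 * L / p%:R by rewrite divr_ge0 ?mulr_ge0// ler0n.
have [|[i b] /= rQi] := rQ (pt q).
  move=> i; rewrite mxE in_itv/=; apply/andP; split.
    by rewrite lerDl mulr_ge0// ler0n.
  rewrite addrC lerBlDr -mulr2n -[L *+ 2]mulr_natl mulrAC ler_pdivrMr ?ltr0n//.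
  by apply: ler_wpM2l; [exact: mulr_ge0|rewrite ler_nat; exact: ltnW (qp i)].
have qball x : (forall j, (q j <= x j <= (q j).+1)%N) -> ball (pt q) r (pt x).
  move=> qx; split=> // k j; rewrite (ord1 k) /ball/= !mxE opprD addrACA.
  rewrite subrr add0r -mulrBr normrM ger0_norm//.
  have : (x j)%:R - (q j)%:R <= 1 :> R.
    by rewrite lerBlDr addrC natr1 ler_nat; case/andP: (qx j).
  have : 0 <= (x j)%:R - (q j)%:R :> R.
    by rewrite subr_ge0 ler_nat; case/andP: (qx j).
  move=> d0 d1; rewrite distrC ger0_norm//.
  apply: (@le_lt_trans _ _ (2 * L / p%:R)); first by rewrite ler_piMr.
  by rewrite ltr_pdivrMr ?ltr0n// [r * _]mulrC -ltr_pdivrMr.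
have [x [y [qx qy uxy]]] := qu i.
have {}Qx := rQi _ (qball _ qx); have {}Qy := rQi _ (qball _ qy).
have [a [c [ua uc Qa Qc]]] : exists a c, [/\ u i a, u i c = false,
    Q (i, b) (pt a) & Q (i, b) (pt c)].
  case ux : (u i x) uxy; case uy : (u i y) => // _; first by exists x, y.
  by exists y, x.
move: Qa Qc; rewrite /Q/=; case: b {rQi Qx Qy} => Qa Qc.
  by have := u1 _ _ ua; rewrite leNgt Qa.
by have := u0 _ _ uc; rewrite leNgt Qc.
Qed.

(** * Means of points of a convex set *)

(** Convexity, with a plain real number as coefficient. *)
Definition segment_closed (R : realType) (V : lmodType R) (K : set V) :=
  forall (t : R) x y, 0 <= t -> t <= 1 -> K x -> K y ->
    K (t *: x + (1 - t) *: y).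

Lemma convex_set_segment_closed (R : realType) (V : lmodType R) (K : set V) :
  convex_set (K : set (convex_lmodType V)) -> segment_closed K.
Proof.
move=> Kconv t x y t0 t1 /mem_set Kx /mem_set Ky.
have ti : Itv.spec (@Itv.num_sem R) (Itv.Real `[0%Z, 1%Z]) t.
  by rewrite /Itv.spec/= /Itv.num_sem/= in_itv/= ger0_real//= t0.
by have := Kconv _ _ (Itv.mk ti) Kx Ky; rewrite inE.
Qed.

Lemma segment_closed_mean (R : realType) (V : lmodType R) (K : set V)
    (m : nat) (w : 'I_m -> R) (y : 'I_m -> V) : segment_closed K ->
  (forall i, 0 <= w i) -> (forall i, K (y i)) -> 0 < \sum_i w i ->
  K ((\sum_i w i)^-1 *: \sum_i w i *: y i).
Proof.
move=> Kconv; elim: m w y => [w y|m IH w y w0 Ky].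
  by rewrite big_ord0 ltxx.
rewrite !big_ord_recl/=.
set S := \sum_(i < m) _; set Y := \sum_(i < m) _ => W0.
have S0 : 0 <= S by apply: sumr_ge0.
have [SE|Sn0] := eqVneq S 0.
  have -> : Y = 0.
    apply: big1 => i _.
    have /(_ i isT) -> := psumr_eq0P (fun i _ => w0 (lift ord0 i)) SE.
    by rewrite scale0r.
  move: W0; rewrite SE !addr0 => W0.
  by rewrite scalerA mulVf ?gt_eqF// scale1r.
have Sgt0 : 0 < S by rewrite lt_neqAle eq_sym Sn0.
have KY : K (S^-1 *: Y) by apply: IH.
have := Kconv (w ord0 / (w ord0 + S)) (y ord0) (S^-1 *: Y) _ _ (Ky _) KY.
have -> : 1 - w ord0 / (w ord0 + S) = S / (w ord0 + S).
  by rewrite -[X in X - _](@mulfV _ (w ord0 + S)) ?gt_eqF// -mulrBl addrC addKr.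
rewrite scalerDr !scalerA [S / _]mulrC mulfK ?gt_eqF// mulrC; apply.
  by rewrite mulr_ge0// invr_ge0 ltW.
by rewrite mulrC ler_pdivrMr// mul1r lerDl.
Qed.

(** * Continuous weights *)

Lemma continuous_max0 (R : realType) (T : topologicalType) (f : T -> R) :
  continuous f -> continuous (fun x => Num.max 0 (f x)).
Proof.
move=> fc x.
apply: (@continuous_max R T (fun=> 0) f x); last exact: fc.
exact: cst_continuous.
Qed.

Lemma continuous_sum (R : realType) (T : topologicalType) (V : normedModType R)
    (m : nat) (f : 'I_m -> T -> V) :
  (forall i, continuous (f i)) -> continuous (fun x => \sum_i f i x).
Proof.
elim: m f => [f _|m IH f fc].
  have -> : (fun x => \sum_i f i x) = fun=> 0.
    by apply/funext => x; rewrite big_ord0.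
  by move=> x; exact: cst_continuous.
have -> : (fun x => \sum_i f i x) =
    (fun x => f ord0 x + \sum_(i < m) f (lift ord0 i) x).
  by apply/funext => x; rewrite big_ord_recl.
by move=> x; apply: cvgD; [exact: fc|apply: IH => i; exact: fc].
Qed.

Lemma continuous_cone (R : realType) (V : normedModType R) (r : R) (z : V) :
  continuous (fun x => r - `|x - z| : R^o).
Proof.
move=> x; apply: cvgB; first exact: cvg_cst.
by apply: cvg_norm; apply: cvgB; [exact: cvg_id|exact: cvg_cst].
Qed.

(** An unnormalized partition of unity.  The functions centered at a finite
    [r / 2]-net have a sum at least [r / 2] on [K]; one more function, which
    vanishes on [K], makes the sum positive on the whole space, so that averages
    weighted by the family are defined everywhere. *)
Lemma bump_family (R : realType) (n : nat) (K : set 'rV[R]_n) (r : R) :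
  compact K -> K !=set0 -> 0 < r ->
  exists (m : nat) (w : 'I_m -> 'rV[R]_n -> R) (z : 'I_m -> 'rV[R]_n),
    [/\ forall i, continuous (w i), forall i x, 0 <= w i x,
        forall i, K (z i), forall x, 0 < \sum_i w i x
      & forall i x, K x -> 0 < w i x -> ball x r (z i)].
Proof.
move=> Kcompact [z0 Kz0] r0.
have [s [sK Ks]] : exists s : seq 'rV[R]_n, (forall z, z \in s -> K z) /\
    forall x, K x -> exists2 z, z \in s & ball z (r / 2) x.
  have [|x Kx|s sK Ks] := (eq_ind _ (@^~ K) Kcompact _ (compact_cover _))
      _ K (fun z => ball z (r / 2)).
  - by move=> z _; exact: ball_open.
  - by exists x => //; apply: ballxx; rewrite divr_gt0.
  exists (finmap.enum_fset s); split=> [z /sK/set_mem//|x /Ks[z /= zs xz]].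
  by exists z.
pose sz j := nth z0 s j.
pose bump j (x : 'rV[R]_n) := Num.max 0 (r - `|x - sz j|).
pose S x := \sum_(j < size s) bump j x.
have bump_ge0 j x : 0 <= bump j x by rewrite le_max lexx.
have bump_cont j : continuous (bump j).
  apply: continuous_max0; exact: continuous_cone.
have S_cont : continuous S.
  exact: continuous_sum.
have S_ge x : K x -> r / 2 <= S x.
  move=> /Ks[z zs]; rewrite -ball_normE /= distrC => xz.
  have zs' : (index z s < size s)%N by rewrite index_mem.
  rewrite /S (bigD1 (Ordinal zs'))//=.
  apply: (@le_trans _ _ (bump (index z s) x)); last by rewrite lerDl sumr_ge0.
  rewrite /bump /sz nth_index// le_max lerBrDr -lerBrDl; apply/orP; right.
  by rewrite {1}[r]splitr addrK ltW.
(* Index [ord0] is the additional function, attached to an arbitrary point. *)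
pose w (i : 'I_(size s).+1) x :=
  if unlift ord0 i is Some j then bump j x else Num.max 0 (r / 2 - S x).
pose z (i : 'I_(size s).+1) := if unlift ord0 i is Some j then sz j else z0.
have w_ge0 i x : 0 <= w i x.
  by rewrite /w; case: unlift => [j|]; rewrite le_max lexx.
exists (size s).+1, w, z; split=> //.
- move=> i; rewrite /w; case: unlift => [j|]; first exact: bump_cont.
  apply: continuous_max0 => x.
  apply: (@continuousB R R^o 'rV[R]_n (fun=> r / 2) S x); last exact: S_cont.
  exact: cst_continuous.
- move=> i; rewrite /z; case: unlift => // j.
  by apply/sK/mem_nth.
- move=> x; rewrite big_ord_recl /w unlift_none.
  under eq_bigr do rewrite liftK.
  rewrite -/(S x) addr_maxl add0r subrK lt_max.
  by rewrite divr_gt0 ?orbT.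
- move=> i x Kx; rewrite /w /z; case: unlift => [j|].
    by rewrite lt_max ltxx/= subr_gt0 -ball_normE.
  by rewrite max_l ?ltxx// subr_le0 S_ge.
Qed.

(** * Mean values and minima *)

(** The one-variable mean value theorem for [t |-> G (x + t *: v)]. *)
Lemma mean_value (R : realType) (n : nat) (G : 'rV[R]_n -> R) (x v : 'rV[R]_n) :
  (forall t : R, 0 <= t -> t <= 1 -> differentiable G (x + t *: v)) ->
  exists t : R, [/\ 0 <= t, t <= 1 & G (x + v) - G x = 'd G (x + t *: v) v].
Proof.
move=> dG; pose f (t : R) := G (x + t *: v).
(* The two derivatives are limits of the same difference quotients. *)
have quotE (t : R) : (fun h : R => h^-1 *: ((f \o shift t) (h *: (1 : R^o)) - f t)) =
    (fun h => h^-1 *: ((G \o shift (x + t *: v)) (h *: v) - G (x + t *: v))).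
  apply/funext => h; rewrite /f /= /shift/=; congr (_ *: (G _ - _)).
  by rewrite [h *: 1]mulr1 scalerDl addrCA.
have f_der (t : R) : 0 <= t -> t <= 1 -> is_derive t (1 : R) f ('d G (x + t *: v) v).
  move=> t0 t1; split.
    rewrite /derivable quotE; apply: diff_derivable; exact: dG.
  by rewrite /derive quotE -[LHS]/('D_v G (x + t *: v)) deriveE//; exact: dG.
have [||t] := @MVT_segment R f (fun t => 'd G (x + t *: v) v) 0 1 ler01.
- by move=> t; rewrite in_itv/= => /andP[t0 t1]; apply: f_der; exact: ltW.
- apply: derivable_within_continuous => t; rewrite in_itv/= => /andP[t0 t1].
  by have [] := f_der _ t0 t1.
rewrite in_itv/= => /andP[t0 t1]; rewrite subr0 mulr1 /f scale1r scale0r addr0.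
by exists t.
Qed.

(** If the infimum [m] is not attained, each point has a neighborhood where [D] is
    at least some [c > m], and compactness makes [c] uniform. *)
Lemma lsc_attains_min (R : realType) (T : topologicalType) (K : set T)
    (D : T -> R) (b : R) : compact K -> K !=set0 ->
  (forall x, K x -> b <= D x) ->
  (forall x c, K x -> c < D x -> \forall y \near x, K y -> c < D y) ->
  exists2 x, K x & forall y, K y -> D x <= D y.
Proof.
move=> /compact_near_coveringP/near_covering_withinP Kc [x0 Kx0] Db Dlsc.
pose m := inf [set D x | x in K].
have Dm y : K y -> m <= D y.
  by move=> Ky; apply: ge_inf; [exists b => _ [x Kx <-]; exact: Db|exists y].
apply: contrapT => /forall2NP nomin.
have Dgt x : K x -> m < D x.
  move=> Kx; have [//|/existsNP[y /not_implyP[Ky /negP]]] := nomin x.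
  by rewrite -ltNge; apply: le_lt_trans; exact: Dm.
have : \forall c \near m^'+, K `<=` (fun y => c <= D y).
  apply: Kc => x Kx; have [c mc cD] : exists2 c, m < c & c < D x.
    by exists ((m + D x) / 2); [exact: (midf_lt (Dgt _ Kx)).1|exact: (midf_lt (Dgt _ Kx)).2].
  exists ([set y | K y -> c < D y], [set d | d < c]) => /=.
    by split; [exact: Dlsc|exact: nbhs_right_lt].
  by move=> [y d]/= [h dc] Ky; apply: (le_trans (ltW dc)); exact/ltW/h.
move=> Kcm; near m^'+ => c.
have cD : K `<=` (fun y => c <= D y) by near: c; exact: Kcm.
have : c <= m.
  by apply: lb_le_inf; [exists (D x0), x0|move=> _ [y Ky <-]; exact: cD].
by rewrite leNgt; apply/negP/negPn; near: c; exact: nbhs_right_gt.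
Unshelve. all: by end_near. Qed.

(** * Polygons that stay in a convex set *)

Lemma coord_le_norm (R : realType) (n : nat) (x : 'rV[R]_n) i :
  `|x ord0 i| <= `|x|.
Proof.
rewrite [leRHS]/Num.norm/= mx_normrE; apply/bigmax_geP; right => /=.
by exists (ord0, i).
Qed.

(** The Euler scheme for the vector field [d], with time step [h]. *)
Fixpoint euler (R : realType) (V : lmodType R) (d : V -> V) (h : R) (z : V)
    (k : nat) : V :=
  if k is k'.+1 then euler d h z k' + h *: d (euler d h z k') else z.

Lemma continuous_scale (R : realType) (T : topologicalType) (V : normedModType R)
    (h : T -> R) (f : T -> V) :
  continuous h -> continuous f -> continuous (fun x => h x *: f x).
Proof. by move=> hc fc x; apply: cvgZ; [exact: hc|exact: fc]. Qed.

Lemma continuous_euler (R : realType) (V : normedModType R) (d : V -> V) (h : R)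
    (k : nat) : continuous d -> continuous (fun z => euler d h z k).
Proof.
move=> dc; elim: k => [|k IH] z /=; first exact: cvg_id.
apply: cvgD; first exact: IH.
apply: cvgZ; first exact: cvg_cst.
apply: (@cvg_comp _ _ _ (fun z => euler d h z k) d); first exact: IH.
exact: dc.
Qed.

(** Choose by Brouwer's theorem a starting point that is the mean of the values of
    [q] along its own polygon.  After [k] time steps of [1 / N], the first [k]
    of these values have been traded for values of [p], so the current vertex
    still is a mean of [N] points of [K]. *)
Lemma polygon_stays_inside (R : realType) (n : nat) (K : set 'rV[R]_n)
    (p q : 'rV[R]_n -> 'rV[R]_n) (N : nat) :
  compact K -> segment_closed K -> continuous p -> continuous q ->
  (forall x, K (p x)) -> (forall x, K (q x)) -> (0 < N)%N ->
  exists z, forall k, (k <= N)%N ->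
    K (euler (fun x => p x - q x) N%:R^-1 z k).
Proof.
move=> Kcompact Kconv pc qc Kp Kq N0.
set d := fun x => p x - q x; set h : R := N%:R^-1.
have dc : continuous d by move=> x; apply: (@continuousB _ _ _ p q x); [exact: pc|exact: qc].
have NR : 0 < N%:R :> R by rewrite ltr0n.
have Kmean (y : nat -> 'rV[R]_n) : (forall i, K (y i)) ->
    K (h *: \sum_(i < N) y i).
  move=> Ky; have := @segment_closed_mean R _ K N (fun=> 1) y Kconv.
  rewrite sumr_const card_ord; under eq_bigr do rewrite scale1r.
  by apply.
have [M [_ /(_ (`|M| + 1))KM]] := compact_bounded Kcompact.
have {}KM x : K x -> `|x| <= `|M| + 1.
  by apply: KM; rewrite (le_lt_trans (ler_norm _))// ltrDl.
pose phi z := h *: \sum_(i < N) q (euler d h z i).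
have Kphi z : K (phi z) by apply: (Kmean (fun i => q (euler d h z i))).
have [|z i|z phiz] := @brouwer_bounded R n phi (`|M| + 1).
- apply: continuous_scale => [z|]; first exact: cst_continuous.
  apply: continuous_sum => i z.
  apply: (@cvg_comp _ _ _ (fun z => euler d h z i) q); last exact: qc.
  exact: continuous_euler.
- by rewrite (le_trans (coord_le_norm _ _))// KM.
exists z => k kN.
(* The induction on [k] trades the value of [q] of index [k] for that of [p]. *)
suff -> : euler d h z k = h *: \sum_(i < N)
    (if (i < k)%N then p (euler d h z i) else q (euler d h z i)).
  apply: (Kmean (fun i => if (i < k)%N then p (euler d h z i)
    else q (euler d h z i))) => i.
  by case: ifP.
elim: k kN => [_|k IH kN] /=; first by rewrite -[LHS]phiz.
rewrite {1}IH 1?ltnW// -scalerDr; congr (_ *: _).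
rewrite [RHS](bigD1 (Ordinal kN))//= ltnSn [X in X + _](bigD1 (Ordinal kN))//=.
rewrite ltnn [LHS]addrC {1}/d addrA subrK; congr (_ + _).
apply: eq_bigr => i; rewrite -val_eqE/= => ik.
by rewrite ltnS [(i <= k)%N]leq_eqVlt (negbTE ik).
Qed.

(** * Oscillation of a smooth function *)

(** Pairs that are good at the points of a finite net remain good on uniform
    balls; averaging them with continuous weights keeps the lower bound, by
    linearity, and the membership to [K], by convexity. *)
Lemma continuous_selection (R : realType) (n : nat) (K : set 'rV[R]_n)
    (l : 'rV[R]_n -> {linear 'rV[R]_n -> R}) (c : R) :
  compact K -> segment_closed K -> K !=set0 ->
  (forall v x, K x -> {for x, continuous (fun y => l y v)}) ->
  (forall x, K x -> exists p q, [/\ K p, K q & c < l x (p - q)]) ->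
  exists r p q, [/\ 0 < r, continuous p /\ continuous q,
    forall x, K (p x), forall x, K (q x)
    & forall x y, K x -> ball x r y -> c <= l y (p x - q x)].
Proof.
move=> Kcompact Kconv K0 lc lgt.
pose Q (pq : 'rV[R]_n * 'rV[R]_n) : set 'rV[R]_n :=
  [set y | [/\ K pq.1, K pq.2 & c < l y (pq.1 - pq.2)]].
have [x Kx|r r0 rQ] := @lebesgue_number _ _ K _ Q Kcompact.
  have [p [q [Kp Kq lpq]]] := lgt _ Kx; exists (p, q).
  have := @cvgr_gt _ _ _ (@nbhs_filter _ x) _ _ (lc (p - q) _ Kx) _ lpq.
  by apply: filterS => y.
have /boolp.choice[a aQ] : forall z, exists pq, K z -> ball z r `<=` Q pq.
  move=> z.
  have [Kz|nKz] := pselect (K z); last by exists (0, 0).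
  by have [pq] := rQ _ Kz; exists pq.
have r20 : 0 < r / 2 by rewrite divr_gt0.
have [m [w [z [wc w0 Kz W0 wz]]]] := bump_family Kcompact K0 r20.
pose W x := \sum_i w i x.
pose avg (b : 'I_m -> 'rV[R]_n) x := (W x)^-1 *: \sum_i w i x *: b i.
have avgc b : continuous (avg b).
  apply: continuous_scale.
    move=> x; apply: (@continuousV R _ W x); first by rewrite gt_eqF// W0.
    exact: (continuous_sum wc).
  apply: continuous_sum => i; apply: continuous_scale; first exact: wc.
  by move=> x; exact: cst_continuous.
have Kavg b x : (forall i, K (b i)) -> K (avg b x).
  by move=> Kb; apply: segment_closed_mean => //; exact: W0.
have aK i : K (a (z i)).1 /\ K (a (z i)).2.
  by have [] := aQ _ (Kz i) _ (ballxx (z i) r0).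
exists (r / 2), (avg (fun i => (a (z i)).1)), (avg (fun i => (a (z i)).2)).
split=> //.
- by move=> x; apply: Kavg => i; exact: (aK i).1.
- by move=> x; apply: Kavg => i; exact: (aK i).2.
move=> x y Kx xy; rewrite /avg -scalerBr -sumrB.
under eq_bigr do rewrite -scalerBr.
rewrite linearZ linear_sum /= ler_pdivlMl ?W0// mulr_suml.
apply: ler_sum => i _; rewrite linearZ/=.
have := w0 i x; rewrite le_eqVlt => /orP[/eqP <-|wix]; first by rewrite mul0r scale0r.
rewrite -[leRHS]/(w i x * _) ler_pM2l//; have [|_ _ /ltW//] := aQ _ (Kz i) y.
by rewrite [r]splitr; apply: ball_triangle xy; apply/ball_sym/wz.
Qed.

(** Follow the field [p - q] given by [continuous_selection] along a polygon that
    does not leave [K], with steps shorter than the radius of validity: each of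
    the [N] steps increases [G] by at least [c / N]. *)
Lemma oscillation_ge (R : realType) (n : nat) (K : set 'rV[R]_n)
    (G : 'rV[R]_n -> R) (c : R) :
  compact K -> segment_closed K -> K !=set0 ->
  (forall x, K x -> differentiable G x) ->
  (forall v x, K x -> {for x, continuous (fun y => 'd G y v)}) ->
  (forall x, K x -> exists p q, [/\ K p, K q & c < 'd G x (p - q)]) ->
  exists x y, [/\ K x, K y & c <= G y - G x].
Proof.
move=> Kcompact Kconv K0 dG dGc dGgt.
have [r [p [q [r0 [pc qc] Kp Kq dpq]]]] :=
  @continuous_selection R n K (fun x => 'd G x) c Kcompact Kconv K0 dGc dGgt.
have [M [_ /(_ (`|M| + 1))KM]] := compact_bounded Kcompact.
have {}KM x : K x -> `|x| <= `|M| + 1.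
  by apply: KM; rewrite (le_lt_trans (ler_norm _))// ltrDl.
set B := `|M| + 1 in KM.
have B0 : 0 <= B by rewrite addr_ge0.
(* The field is bounded by [2 * B]: with this many steps, each step is shorter
   than [r]. *)
pose N := (Num.bound (2 * B / r)).
have BN : 2 * B / r < N%:R by apply: archi_boundP; rewrite divr_ge0 ?mulr_ge0// ltW.
have N0 : (0 < N)%N.
  by rewrite -(@ltr_nat R) (le_lt_trans _ BN)// divr_ge0 ?mulr_ge0// ltW.
have NR : 0 < N%:R :> R by rewrite ltr0n.
have [z Kz] := polygon_stays_inside Kcompact Kconv pc qc Kp Kq N0.
set d := fun x => p x - q x in Kz.
pose x k := euler d N%:R^-1 z k.
have dB y : `|d y| <= 2 * B.
  by rewrite (le_trans (ler_normB _ _))// mulr2n mulrDl mul1r lerD// KM.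
have step_ge k : (k < N)%N -> c / N%:R <= G (x k.+1) - G (x k).
  move=> kN; rewrite [x k.+1]/(x k + N%:R^-1 *: d (x k)).
  set v := N%:R^-1 *: d (x k).
  have Kt t : 0 <= t -> t <= 1 -> K (x k + t *: v).
    move=> t0 t1; have := Kconv t _ _ t0 t1 (Kz _ kN) (Kz _ (ltnW kN)).
    rewrite /= -/(x k) -/v scalerDr addrAC -scalerDl addrCA subrr addr0.
    by rewrite scale1r.
  have [t t0 t1|t [t0 t1 ->]] := @mean_value R n G (x k) v.
    exact/dG/Kt.
  rewrite linearZ/= mulrC ler_pM2l ?invr_gt0//; apply: dpq.
    exact/Kz/ltnW.
  rewrite -ball_normE /= opprD addNKr normrN normrZ (ger0_norm t0).
  apply: (@le_lt_trans _ _ `|v|); first by rewrite ler_piMl.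
  rewrite normrZ ger0_norm ?invr_ge0 ?ltW// ltr_pdivrMl//.
  by apply: (le_lt_trans (dB _)); rewrite -ltr_pdivrMr.
exists (x 0%N), (x N); split; [exact: Kz|exact: Kz|].
rewrite -(telescope_sumr (fun k => G (x k)) (leq0n N)).
rewrite -[c](divfK (lt0r_neq0 NR)) mulr_natr -[N in X in X <= _]subn0 -sumr_const_nat.
by apply: ler_sum_nat => k /andP[_]; exact: step_ge.
Qed.

(** * The norm dual to a difference body *)

(** The unit ball being [K - K], the dual norm of [l] is the oscillation of [l]
    on [K]. *)
Section DualNorm.
Context {R : realType} {n : nat} (K : set 'rV[R]_n) (N : 'rV[R]_n -> R).
Hypotheses (Kcompact : compact K) (K0 : K !=set0).
Hypothesis hN : norm_with_unit_ball (difference_body K) N.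
Variable l : {linear 'rV[R]_n -> R}.
Hypothesis lc : continuous l.

Lemma le_dual_norm p q : K p -> K q -> l (p - q) <= dual_norm N l.
Proof.
move=> Kp Kq.
have [a _ amax] := EVT_max_rV K0 Kcompact (continuous_subspaceT lc).
have [b _ bmin] := EVT_min_rV K0 Kcompact (continuous_subspaceT lc).
apply: (le_trans (ler_norm _)); apply: ub_le_sup; last first.
  by exists (p - q) => //; rewrite hN.2; exists p => //; exists q.
exists (l a - l b) => _ [v + <-]; rewrite hN.2 => -[p' Kp' [q' Kq' <-]].
rewrite linearB ler_norml opprB.
by rewrite !lerB ?amax ?bmin//; exact/mem_set.
Qed.

Lemma lt_dual_norm c : c < dual_norm N l ->
  exists p q, [/\ K p, K q & c < l (p - q)].
Proof.
have [x0 Kx0] := K0.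
move=> /sup_gt[]; first by exists `|l (x0 - x0)|, (x0 - x0) => //;
  rewrite hN.2; exists x0 => //; exists x0.
move=> _ [v + <-]; rewrite hN.2 => -[p Kp [q Kq <-]].
rewrite ltr_normr => /orP[|]; first by exists p, q.
by rewrite -linearN opprB; exists q, p.
Qed.

End DualNorm.

Unset Implicit Arguments.
Set Strict Implicit.

Theorem theorem6p3 (R : realType) (n : nat) (K : set 'rV[R]_n)
    (hK : convex_body K)
    (F G : 'rV[R]_n -> R) (hF : C1_extension K F G)
    (N : 'rV[R]_n -> R) (hN : norm_with_unit_ball (difference_body K) N) :
  exists maxF minF mindF : R,
    [/\ is_max [set F x | x in K] maxF,
        is_min [set F x | x in K] minF,
        is_min [set dual_norm N ('d G x) | x in K] mindF
      & maxF - minF >= mindF].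
Proof.
have [Kcompact /convex_set_segment_closed Kconv [x0 /nbhs_singleton Kx0]] := hK.
have K0 : K !=set0 by exists x0.
have [FG [U [_ KU [GdU GcU]]]] := hF.
have Gd x : K x -> differentiable G x by move=> /KU/mem_set; exact: GdU.
have Gc v x : K x -> {for x, continuous (fun y => 'd G y v)}.
  by move=> /KU/mem_set; exact: GcU.
have dc x : K x -> continuous ('d G x).
  by move=> Kx; apply: diff_continuous; exact: Gd.
have G_cont : {within K, continuous G}.
  apply: continuous_in_subspaceT => x /set_mem Kx.
  exact/differentiable_continuous/Gd.
have [a /set_mem Ka amax] := EVT_max_rV K0 Kcompact G_cont.
have [b /set_mem Kb bmin] := EVT_min_rV K0 Kcompact G_cont.
have FE x : K x -> F x = G x by move=> /mem_set; exact: FG.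
(* A pair of points of [K] witnessing [c < dual_norm] at [x] still does so
   near [x]: the dual norm of the differential is lower semicontinuous. *)
have [|x c Kx cD|e Ke emin] := @lsc_attains_min R _ K
  (fun x => dual_norm N ('d G x)) 0 Kcompact K0.
- move=> x Kx; have := le_dual_norm Kcompact K0 hN (dc _ Kx) Kx0 Kx0.
  by rewrite subrr linear0.
- have [p [q [Kp Kq cpq]]] := lt_dual_norm K0 hN cD.
  have := @cvgr_gt _ _ _ (@nbhs_filter _ x) _ _ (Gc (p - q) _ Kx) _ cpq.
  apply: filterS => y /= cy Ky; apply: (lt_le_trans cy).
  exact: (le_dual_norm Kcompact K0 hN (dc _ Ky)).
exists (F a), (F b), (dual_norm N ('d G e)); split.
- split; first by exists a.
  by move=> _ [x Kx <-]; rewrite !FE// amax//; exact/mem_set.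
- split; first by exists b.
  by move=> _ [x Kx <-]; rewrite !FE// bmin//; exact/mem_set.
- by split=> [|_ [x Kx <-]]; [exists e|exact: emin].
rewrite !FE// leNgt; apply/negP => lt_osc.
have [gt_mid mid_lt] := midf_lt lt_osc.
(* A constant below all the dual norms and above the oscillation. *)
set c := (_ / 2) in gt_mid mid_lt.
have [x Kx|x [y [Kx Ky]]] := @oscillation_ge R n K G c Kcompact Kconv K0 Gd Gc.
  by apply: (lt_dual_norm K0 hN); exact: lt_le_trans mid_lt (emin _ Kx).
apply/negP; rewrite -ltNge; apply: le_lt_trans gt_mid.
by rewrite lerB ?amax ?bmin//; exact/mem_set.
Qed.
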